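(* Let $S$ be a semidomain and let $I$ be a nonzero finitely generated ideal of $S$. Then $I$ is invertible if and only if $I_{\mathfrak m}$ is a principal ideal of $S_{\mathfrak m}$ for each maximal ideal $\mathfrak m$ of $S$.
   Context: A semiring is a set $S$ with operations $+,\cdot$ such that $(S,+)$ is a commutative monoid with identity $0$, $(S,\cdot)$ is a commutative monoid with identity $1\neq 0$, multiplication distributes over addition, and $s\cdot 0=0$ for all $s\in S$. An ideal of $S$ is a nonempty subset $I\subseteq S$ such that $a,b\in I$ and $s\in S$ imply $a+b, sa\in I$. A maximal ideal is an ideal maximal among the ideals $\neq S$; maximal ideals are prime. An element $s\in S$ is multiplicatively cancellable (MC) if $sb=sc$ implies $b=c$ for all $b,c\in S$; $S$ is a semidomain if every nonzero element of $S$ is MC. Localization: for a multiplicatively closed set $T\subseteq S$, $S_T$ is the set of equivalence classes $a/b$ of pairs $(a,b)\in S\times T$ under $(a,b)\sim(c,d)$ iff $tad=tbc$ for some $t\in T$, with $a/b+c/d=(ad+bc)/(bd)$ and $(a/b)(c/d)=(ac)/(bd)$. For an ideal $I$, $I_T=\{a/t: a\in I,\ t\in T\}$. For a maximal (or prime) ideal $\mathfrak m$, $S_{\mathfrak m}$ and $I_{\mathfrak m}$ denote $S_T$ and $I_T$ with $T=S-\mathfrak m$. The total quotient semiring $Q(S)$ is the localization of $S$ at the set of its MC elements, and $S$ is viewed inside $Q(S)$ via $s\mapsto s/1$. A fractional ideal of $S$ is a nonempty subset $I\subseteq Q(S)$ closed under addition and under multiplication by elements of $S$, such that $dI\subseteq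 S$ for some MC element $d\in S$. The product of fractional ideals is $IJ=\{a_1b_1+\cdots+a_nb_n: a_i\in I,\ b_i\in J\}$. A fractional ideal (in particular an ideal) $I$ of $S$ is invertible if $IJ=S$ for some fractional ideal $J$ of $S$. *)

(* Defs.v *)
From HB Require Import structures.
From mathcomp Require Import all_boot ssralg generic_quotient.
From mathcomp Require Import boolp classical_sets ring.

Set Implicit Arguments.
Unset Strict Implicit.
Unset Printing Implicit Defensive.

Import GRing.Theory.
Local Open Scope classical_set_scope.
Local Open Scope ring_scope.
Local Open Scope quotient_scope.

(* A semiring with 1 != 0 is a [comNzSemiRingType]. Localizations are built as
   [comPzSemiRingType]s, where 1 = 0 is allowed, because a multiplicatively
   closed set may contain 0. *)

Section Ideals.
Variable S : comPzSemiRingType.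
Implicit Types (I J : set S).

Definition ideal I : Prop :=
  [/\ I !=set0,
      forall a b, I a -> I b -> I (a + b)
    & forall s a, I a -> I (s * a)].

Definition maximal_ideal I : Prop :=
  [/\ ideal I, I <> setT
    & forall J, ideal J -> J <> setT -> I `<=` J -> J = I].

Definition prime_ideal I : Prop :=
  [/\ ideal I, I <> setT & forall a b, I (a * b) -> I a \/ I b].

Definition principal_ideal I : Prop :=
  exists x, I = [set s * x | s in [set: S]].

Definition finitely_generated I : Prop :=
  exists (n : nat) (a : 'I_n -> S),
    I = [set \sum_(i < n) s i * a i | s in [set: 'I_n -> S]].

Definition cancellable (s : S) : Prop :=
  forall b c, s * b = s * c -> b = c.

Lemma ideal0 I : ideal I -> I 0.
Proof. by case=> -[a Ia] _ /(_ 0 a Ia); rewrite mul0r. Qed.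

Lemma ideal1 I : ideal I -> I 1 -> I = setT.
Proof.
case=> _ _ IM I1; apply/seteqP; split=> // x _.
by rewrite -[x]mulr1; exact: IM.
Qed.

Lemma maximal_prime I : maximal_ideal I -> prime_ideal I.
Proof.
case=> idI IT Imax; split=> // a b Iab; have [|nIa] := pselect (I a); first by left.
right; have [_ ID IM] := idI.
pose J := [set x | exists y s, I y /\ x = y + s * a].
have idJ : ideal J.
  split.
  - by exists 0, 0, 0; split; [exact: ideal0|rewrite mul0r addr0].
  - move=> _ _ [y [s [Iy ->]]] [z [t [Iz ->]]]; exists (y + z), (s + t).
    by split; [exact: ID|rewrite mulrDl addrACA].
  - move=> t _ [y [s [Iy ->]]]; exists (t * y), (t * s).
    by split; [exact: IM|rewrite mulrDr mulrA].
have IJ : I `<=` J by move=> y Iy; exists y, 0; rewrite mul0r addr0.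
have Ja : J a by exists 0, 1; rewrite mul1r add0r; split=> //; exact: ideal0.
have [JT|JT] := pselect (J = setT); last first.
  by case: nIa; rewrite -(Imax _ idJ JT IJ).
have [y [s [Iy e]]] : J 1 by rewrite JT.
rewrite -[b]mul1r e mulrDl -mulrA; apply: ID; last exact: IM.
by rewrite mulrC; exact: IM.
Qed.

End Ideals.

Definition semidomain (S : comNzSemiRingType) : Prop :=
  forall s : S, s != 0 -> cancellable s.

Record mulset (S : comPzSemiRingType) := MulSet {
  mulset_set :> set S;
  mulset1 : mulset_set 1;
  mulsetM : forall a b, mulset_set a -> mulset_set b -> mulset_set (a * b)
}.

Definition denominator (S : comPzSemiRingType) (T : mulset S) : Type :=
  {t : S | t \in (T : set S)}.

HB.instance Definition _ (S : comPzSemiRingType) (T : mulset S) :=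
  Choice.on (denominator T).

Definition den (S : comPzSemiRingType) (T : mulset S) (t : denominator T) : S :=
  val t.

Section Localization.
Variables (S : comPzSemiRingType) (T : mulset S).
Implicit Types (a b : S) (t u : denominator T) (x y : S * denominator T).

Definition loc_rel x y : bool :=
  `[< exists2 v, mulset_set T v &
        v * (x.1 * den y.2) = v * (den x.2 * y.1) >].

Lemma den_mulset t : mulset_set T (den t).
Proof. exact: set_mem (valP t). Qed.

Fact loc_rel_refl : reflexive loc_rel.
Proof.
move=> x; apply/asboolP; exists 1; [exact: mulset1|].
by rewrite [x.1 * _]mulrC.
Qed.

Fact loc_rel_sym : symmetric loc_rel.
Proof.
by move=> x y; apply/asboolP/asboolP=> -[t Tt e]; exists t => //;
   rewrite mulrC [X in X * _]mulrC mulrC -e; congr (_ * _); rewrite mulrC.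
Qed.

Fact loc_rel_trans : transitive loc_rel.
Proof.
move=> [b b'] [a a'] [c c'] /asboolP[/= t Tt e1] /asboolP[/= u Tu e2].
apply/asboolP; exists (t * u * den b') => /=.
  by do 2?apply: mulsetM => //; exact: den_mulset.
transitivity (t * (a * den b') * (u * den c')); first by ring.
rewrite e1; transitivity (t * den a' * (u * (b * den c'))); first by ring.
by rewrite e2; ring.
Qed.

Canonical loc_equiv := EquivRel loc_rel loc_rel_refl loc_rel_sym loc_rel_trans.

Definition loc := {eq_quot loc_rel}.

HB.instance Definition _ : EqQuotient _ loc_rel loc := EqQuotient.on loc.
HB.instance Definition _ := Choice.on loc.

Definition frac a t : loc := \pi_loc (a, t).

Definition den1 : denominator T := exist _ 1 (mem_set (mulset1 T)).

Definition denM t u : denominator T :=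
  exist _ (den t * den u)
    (mem_set (mulsetM (den_mulset t) (den_mulset u))).

Lemma denME t u : den (denM t u) = den t * den u. Proof. by []. Qed.

Lemma den1E : den den1 = 1. Proof. by []. Qed.

Lemma frac_eq a t b u : frac a t = frac b u <->
  exists2 v, mulset_set T v & v * (a * den u) = v * (den t * b).
Proof. by split=> [/eqmodP/asboolP|e] //; apply/eqmodP/asboolP. Qed.

Lemma frac_surj (z : loc) : exists a t, z = frac a t.
Proof. by elim/quotW: z => -[a t]; exists a, t. Qed.

(* Addition and multiplication are computed on chosen representatives;
   [loc_addE] and [loc_mulE] show that any representatives may be used. *)
Definition loc_add (z w : loc) : loc :=
  frac ((repr z).1 * den (repr w).2 + den (repr z).2 * (repr w).1)
       (denM (repr z).2 (repr w).2).

Definition loc_mul (z w : loc) : loc :=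
  frac ((repr z).1 * (repr w).1) (denM (repr z).2 (repr w).2).

Lemma repr_frac a t : exists2 v, mulset_set T v &
  v * ((repr (frac a t)).1 * den t) = v * (den (repr (frac a t)).2 * a).
Proof. by apply/frac_eq; rewrite -[RHS]reprK /frac; case: (repr _). Qed.

Lemma loc_addE a t b u :
  loc_add (frac a t) (frac b u) = frac (a * den u + den t * b) (denM t u).
Proof.
rewrite /loc_add; have [v Tv] := repr_frac a t; have [w Tw] := repr_frac b u.
case: (repr (frac a t)) (repr (frac b u)) => [a' t'] [b' u'] /= e2 e1.
apply/frac_eq; exists (v * w); first exact: mulsetM.
rewrite !denME.
transitivity (v * (a' * den t) * (w * den u' * den u)
              + w * (b' * den u) * (v * den t' * den t)); first by ring.
by rewrite e1 e2; ring.
Qed.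

Lemma loc_mulE a t b u :
  loc_mul (frac a t) (frac b u) = frac (a * b) (denM t u).
Proof.
rewrite /loc_mul; have [v Tv] := repr_frac a t; have [w Tw] := repr_frac b u.
case: (repr (frac a t)) (repr (frac b u)) => [a' t'] [b' u'] /= e2 e1.
apply/frac_eq; exists (v * w); first exact: mulsetM.
rewrite !denME.
transitivity (v * (a' * den t) * (w * (b' * den u))); first by ring.
by rewrite e1 e2; ring.
Qed.

Let eq_frac a t b u : a * den u = den t * b -> frac a t = frac b u.
Proof. by move=> e; apply/frac_eq; exists 1; [exact: mulset1|rewrite e]. Qed.

Fact loc_addA : associative loc_add.
Proof.
move=> x y z; have [a [t ->]] := frac_surj x; have [b [u ->]] := frac_surj y.
have [c [v ->]] := frac_surj z; rewrite !loc_addE.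
by apply: eq_frac; rewrite ?(denME, den1E); ring.
Qed.

Fact loc_addC : commutative loc_add.
Proof.
move=> x y; have [a [t ->]] := frac_surj x; have [b [u ->]] := frac_surj y.
by rewrite !loc_addE; apply: eq_frac; rewrite ?(denME, den1E); ring.
Qed.

Fact loc_add0 : left_id (frac 0 den1) loc_add.
Proof.
move=> x; have [a [t ->]] := frac_surj x.
by rewrite !loc_addE; apply: eq_frac; rewrite ?(denME, den1E); ring.
Qed.

HB.instance Definition _ :=
  GRing.isNmodule.Build loc loc_addA loc_addC loc_add0.

Fact loc_mulA : associative loc_mul.
Proof.
move=> x y z; have [a [t ->]] := frac_surj x; have [b [u ->]] := frac_surj y.
have [c [v ->]] := frac_surj z; rewrite !loc_mulE.
by apply: eq_frac; rewrite ?(denME, den1E); ring.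
Qed.

Fact loc_mulC : commutative loc_mul.
Proof.
move=> x y; have [a [t ->]] := frac_surj x; have [b [u ->]] := frac_surj y.
by rewrite !loc_mulE; apply: eq_frac; rewrite ?(denME, den1E); ring.
Qed.

Fact loc_mul1 : left_id (frac 1 den1) loc_mul.
Proof.
move=> x; have [a [t ->]] := frac_surj x.
by rewrite !loc_mulE; apply: eq_frac; rewrite ?(denME, den1E); ring.
Qed.

Fact loc_mulDl : left_distributive loc_mul loc_add.
Proof.
move=> x y z; have [a [t ->]] := frac_surj x; have [b [u ->]] := frac_surj y.
have [c [v ->]] := frac_surj z; rewrite !(loc_mulE, loc_addE).
by apply: eq_frac; rewrite ?(denME, den1E); ring.
Qed.

Fact loc_mul0 : left_zero (frac 0 den1) loc_mul.
Proof.
move=> x; have [a [t ->]] := frac_surj x.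
by rewrite !loc_mulE; apply: eq_frac; rewrite ?(denME, den1E); ring.
Qed.

HB.instance Definition _ := GRing.Nmodule_isComPzSemiRing.Build loc
  loc_mulA loc_mulC loc_mul1 loc_mulDl loc_mul0.

Lemma fracD a t b u :
  frac a t + frac b u = frac (a * den u + den t * b) (denM t u).
Proof. exact: loc_addE. Qed.

Lemma fracM a t b u : frac a t * frac b u = frac (a * b) (denM t u).
Proof. exact: loc_mulE. Qed.

Lemma frac0 : frac 0 den1 = 0. Proof. by []. Qed.

Lemma frac1 : frac 1 den1 = 1. Proof. by []. Qed.

Definition loc_ideal (I : set S) : set loc :=
  [set z | exists a t, I a /\ z = frac a t].

End Localization.

Arguments loc_ideal {S} T I.

Section PrimeLocalization.
Variables (S : comPzSemiRingType) (p : set S) (pP : prime_ideal p).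

Fact prime_compl1 : (~` p) 1.
Proof. by case: pP => idp pT _ p1; exact: pT (ideal1 idp p1). Qed.

Fact prime_complM a b : (~` p) a -> (~` p) b -> (~` p) (a * b).
Proof. by case: pP => _ _ pM pa pb /pM[]. Qed.

Definition prime_compl : mulset S := MulSet prime_compl1 prime_complM.

End PrimeLocalization.

Section TotalQuotient.
Variable S : comPzSemiRingType.

Fact cancellable1 : [set s : S | cancellable s] 1.
Proof. by move=> b c; rewrite !mul1r. Qed.

Fact cancellableM a b :
  [set s : S | cancellable s] a -> [set s : S | cancellable s] b ->
  [set s : S | cancellable s] (a * b).
Proof. by move=> ca cb x y; rewrite -!mulrA => /ca/cb. Qed.

Definition cancellables : mulset S := MulSet cancellable1 cancellableM.

Definition total_quotient := loc cancellables.

HB.instance Definition _ := GRing.ComPzSemiRing.on total_quotient.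

Definition to_quotient (s : S) : total_quotient := frac s (den1 cancellables).

Definition fractional_ideal (I : set total_quotient) : Prop :=
  [/\ I !=set0,
      forall x y, I x -> I y -> I (x + y),
      forall s x, I x -> I (to_quotient s * x)
    & exists2 d, cancellable d &
        forall x, I x -> range to_quotient (to_quotient d * x)].

Definition fractional_mul (I J : set total_quotient) : set total_quotient :=
  [set x | exists (n : nat) (a b : 'I_n -> total_quotient),
     [/\ forall i, I (a i), forall i, J (b i) & x = \sum_(i < n) a i * b i]].

Definition fractional_invertible (I : set total_quotient) : Prop :=
  exists2 J, fractional_ideal J & fractional_mul I J = range to_quotient.

Definition invertible (I : set S) : Prop :=
  fractional_invertible (to_quotient @` I).

Lemma ideal_fractional (I : set S) :
  ideal I -> fractional_ideal (to_quotient @` I).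
Proof.
have E s t : to_quotient s * to_quotient t = to_quotient (s * t).
  rewrite /to_quotient fracM; apply/frac_eq; exists 1; first exact: cancellable1.
  by rewrite ?(denME, den1E) !mul1r ?mulr1.
move=> [[x Ix] ID IM]; split.
- by exists (to_quotient x), x.
- move=> _ _ [a Ia <-] [b Ib <-]; exists (a + b); first exact: ID.
  rewrite /to_quotient fracD; apply/frac_eq; exists 1; first exact: cancellable1.
  by rewrite ?(denME, den1E) !mul1r ?mulr1.
- by move=> s _ [a Ia <-]; exists (s * a); [exact: IM|rewrite E].
- by exists 1; [exact: cancellable1|move=> _ [a Ia <-]; rewrite E; exists (1 * a)].
Qed.

End TotalQuotient.

(* Main.v *)
Require Import Defs.
From mathcomp Require Import all_boot ssralg classical_sets.
From mathcomp Require Import boolp ring.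

Set Implicit Arguments.
Unset Strict Implicit.
Unset Printing Implicit Defensive.

Import GRing.Theory.
Local Open Scope classical_set_scope.
Local Open Scope ring_scope.

(** Both directions rest on one description of local principality: when [I] is
    finitely generated, [I] becomes principal after inverting [T] exactly when
    some [a] in [I] and [u] in [T] satisfy [u I <= S a]
    ([principal_loc_ideal], [loc_ideal_generator]).

    If [I J = S], write [1 = a_1 b_1 + ... + a_n b_n]. Each [a_i b_i] lies in
    [S], and since a maximal ideal [m] does not contain 1, some
    [u = a_i b_i] lies outside [m]. Then [u x = (x b_i) a_i] with [x b_i] in
    [S] for every [x] in [I], so [a_i] generates [I] at [m]
    ([invertible_locally_principal]).

    Conversely, take for [J] the largest candidate, the set of all [y] in
    [Q(S)] with [I y <= S]. Then [I J] is an ideal of [S]; if it were proper it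
    would lie in a maximal ideal [m] by Zorn's lemma. With [a] in [I] and [u]
    outside [m] such that [u I <= S a], the fraction [u / a] belongs to [J], so
    [u = a (u / a)] belongs to [I J <= m], a contradiction
    ([locally_principal_invertible]). *)

(** * Ideals of a semiring *)

Section IdealTheory.
Variable S : comPzSemiRingType.
Implicit Types I J m : set S.

Lemma ideal_sum I n (a : 'I_n -> S) :
  ideal I -> (forall i, I (a i)) -> I (\sum_(i < n) a i).
Proof.
move=> idI Ia; have [_ ID _] := idI.
by apply: big_ind => //; exact: ideal0 idI.
Qed.

Lemma proper_ideal1 I : ideal I -> I <> setT -> ~ I 1.
Proof. by move=> idI IT I1; exact: IT (ideal1 idI I1). Qed.

Lemma exists_maximal_ideal I :
  ideal I -> I <> setT -> exists2 m, maximal_ideal m & I `<=` m.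
Proof.
move=> idI IT.
pose proper (X : set S) := ideal X /\ ~ X 1.
have pI : proper I by split=> //; exact: proper_ideal1.
(* Joining with I takes care of the empty chain. *)
pose P : set (set S) := [set X | proper (I `|` X)].
have [F FP totF|M [[idM M1] maxM]] := @Zorn_bigcup S P.
  set U := \bigcup_(X in F) X.
  (* The ideal axioms involve at most two elements at a time, and any two
     elements of the union already lie in one proper ideal inside it. *)
  have common a b : (I `|` U) a -> (I `|` U) b ->
      exists Y, [/\ proper Y, Y a, Y b & Y `<=` I `|` U].
    have FU X : F X -> I `|` X `<=` I `|` U.
      by move=> FX x [Ix|Xx]; [left|right; exists X].
    move=> [Ia|[X FX Xa]] [Ib|[Y FY Yb]].
    - by exists I; split=> // x Ix; left.
    - by exists (I `|` Y); split; [exact: FP|left|right|exact: FU].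
    - by exists (I `|` X); split; [exact: FP|right|left|exact: FU].
    - have [XY|YX] := totF _ _ FX FY.
      + by exists (I `|` Y); split; [exact: FP|right; exact: XY|right|exact: FU].
      + by exists (I `|` X); split; [exact: FP|right|right; exact: YX|exact: FU].
  split; last by move=> U1; have [Y [[_ + Y1 _ _]]] := common _ _ U1 U1; apply.
  split.
  - by have [[x Ix] _ _] := idI; exists x; left.
  - move=> a b Ua Ub; have [Y [[[_ YD _] _] Ya Yb YU]] := common _ _ Ua Ub.
    exact/YU/YD.
  - move=> s a Ua; have [Y [[[_ _ YM] _] Ya _ YU]] := common _ _ Ua Ua.
    exact/YU/YM.
exists (I `|` M) => [|x Ix]; last by left.
split=> // [MT|J idJ JT MJ]; first by apply: M1; rewrite MT.
apply/seteqP; split=> // x Jx; apply: contrapT => nMx.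
apply: (maxM J).
  split; first by move=> y My; apply: MJ; right.
  by move=> JM; apply: nMx; right; exact: JM.
have -> : P J = proper J.
  by rewrite /P /=; congr proper; apply/setUidPr => y Iy; apply: MJ; left.
by split=> //; exact: proper_ideal1.
Qed.

(** The local-to-global step: it remains to find, for each maximal ideal, one
    element of [I] outside it. *)
Lemma ideal_eq_setT I :
  ideal I -> (forall m, maximal_ideal m -> ~ I `<=` m) -> I = setT.
Proof.
move=> idI nIm; apply: contrapT => IT.
by have [m mP Im] := exists_maximal_ideal idI IT; exact: nIm mP Im.
Qed.

End IdealTheory.

(** * The canonical map to the total quotient semiring *)

Section ToQuotient.
Variable S : comPzSemiRingType.
Implicit Types a b d : S.

Lemma to_quotientM a b : to_quotient (a * b) = to_quotient a * to_quotient b.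
Proof.
rewrite /to_quotient fracM; apply/frac_eq; exists 1; first exact: cancellable1.
by rewrite denME den1E !mul1r mulr1.
Qed.

Lemma to_quotientD a b : to_quotient (a + b) = to_quotient a + to_quotient b.
Proof.
rewrite /to_quotient fracD; apply/frac_eq; exists 1; first exact: cancellable1.
by rewrite denME den1E !mul1r !mulr1.
Qed.

Lemma to_quotient_sum n (a : 'I_n -> S) :
  to_quotient (\sum_(i < n) a i) = \sum_(i < n) to_quotient (a i).
Proof. by apply: (big_morph _ to_quotientD). Qed.

Lemma to_quotient_inj : injective (@to_quotient S).
Proof.
move=> a b /frac_eq[v cv]; rewrite den1E mulr1 mul1r; exact: cv.
Qed.

Lemma to_quotient_unit d :
  cancellable d -> exists y, to_quotient d * y = 1.
Proof.
move=> cd; pose t : denominator (cancellables S) := exist _ d (mem_set cd).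
exists (frac 1 t); rewrite /to_quotient fracM -frac1.
apply/frac_eq; exists 1; first exact: cancellable1.
by rewrite denME den1E /den /=; ring.
Qed.

End ToQuotient.

(** * Products of fractional ideals *)

Section FractionalMul.
Variable S : comPzSemiRingType.
Implicit Types (I J : set (total_quotient S)).

Lemma fractional_mul_mem I J a b : I a -> J b -> fractional_mul I J (a * b).
Proof.
move=> Ia Jb; exists 1%N, (fun=> a), (fun=> b).
by split=> //; rewrite big_ord1.
Qed.

(** Concatenating two sums of products gives a sum of products. *)
Lemma fractional_mulD I J x y :
  fractional_mul I J x -> fractional_mul I J y -> fractional_mul I J (x + y).
Proof.
move=> [m [a [b [Ia Jb ->]]]] [n [c [d [Ic Jd ->]]]].
pose glue (f : 'I_m -> total_quotient S) (g : 'I_n -> total_quotient S) i :=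
  match split i with inl j => f j | inr k => g k end.
exists (m + n)%N, (glue a c), (glue b d); split.
- by move=> i; rewrite /glue; case: split.
- by move=> i; rewrite /glue; case: split.
rewrite big_split_ord /=; congr (_ + _); apply: eq_bigr => i _; rewrite /glue.
  by rewrite -[lshift _ i]/(unsplit (inl i)) unsplitK.
by rewrite -[rshift _ i]/(unsplit (inr i)) unsplitK.
Qed.

Lemma fractional_mulZ I J s x :
  (forall y, I y -> I (to_quotient s * y)) ->
  fractional_mul I J x -> fractional_mul I J (to_quotient s * x).
Proof.
move=> IM [n [a [b [Ia Jb ->]]]].
exists n, (fun i => to_quotient s * a i), b; split=> // [i|]; first exact: IM.
by rewrite mulr_sumr; apply: eq_bigr => i _; rewrite mulrA.
Qed.

End FractionalMul.

(** * Local generators *)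

Section LocalGenerators.
Variable S : comPzSemiRingType.
Implicit Types (I : set S) (T : mulset S).

(** The fraction [x / t] equals [(s / (u t)) (a / 1)] whenever [u x = s a], so
    [a / 1] generates the localized ideal. *)
Lemma principal_loc_ideal T I a u :
  ideal I -> I a -> mulset_set T u ->
  (forall x, I x -> exists s, u * x = s * a) -> principal_ideal (loc_ideal T I).
Proof.
move=> [_ _ IM] Ia Tu uI; exists (frac a (den1 T)); apply/seteqP; split.
  move=> _ [x [t [Ix ->]]]; have [s e] := uI x Ix.
  pose ut : denominator T := exist _ u (mem_set Tu).
  exists (frac s (denM ut t)) => //; rewrite fracM; apply/frac_eq.
  exists 1; first exact: mulset1.
  by rewrite !denME den1E -e -[den ut]/u; ring.
move=> _ [z _ <-]; have [r [v ->]] := frac_surj z.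
by exists (r * a), (denM v (den1 T)); split; [exact: IM|exact: fracM].
Qed.

(** A generator of the localized ideal may be taken with its numerator [a] in
    [I]. Each of the finitely many generators [g i] of [I] then satisfies
    [u_i (g i) = s_i a] for some [u_i] in [T], and the product of the [u_i] is a
    denominator that serves all of [I]; finite generation is what makes this
    product available. *)
Lemma loc_ideal_generator T I :
  finitely_generated I -> principal_ideal (loc_ideal T I) ->
  exists a u, [/\ I a, mulset_set T u &
    forall x, I x -> exists s, u * x = s * a].
Proof.
move=> [n [g defI]] [z defIT].
have Ig i : I (g i).
  rewrite defI; exists (fun j => if j == i then 1 else 0) => //.
  rewrite (bigD1 i) //= eqxx mul1r big1 ?addr0 // => j /negPf ->.
  by rewrite mul0r.
have [a [t [Ia ez]]] : loc_ideal T I z by rewrite defIT; exists 1; rewrite ?mul1r.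
have /choice[us usP] i : exists us : S * S,
    mulset_set T us.1 /\ us.1 * g i = us.2 * a.
  have : loc_ideal T I (frac (g i) (den1 T)) by exists (g i), (den1 T).
  rewrite defIT ez => -[w _]; have [s [v ->]] := frac_surj w.
  rewrite fracM => /frac_eq[v' Tv' e].
  exists (v' * den (denM v t), v' * s); split; last first.
    by move: e; rewrite den1E mulr1 -[(_, _).1]/(v' * _) -!mulrA => <-.
  by apply: mulsetM => //; exact: den_mulset.
exists a, (\prod_i (us i).1); split=> //.
  apply: big_ind => [|b c|i _]; [exact: mulset1|exact: mulsetM|].
  by case: (usP i).
rewrite defI => _ [r _ <-].
exists (\sum_i r i * (us i).2 * \prod_(j | j != i) (us j).1).
rewrite mulr_sumr mulr_suml; apply: eq_bigr => i _.
rewrite (bigD1 i) //=; have [_ e] := usP i.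
transitivity (r i * ((us i).1 * g i) * \prod_(j | j != i) (us j).1); first by ring.
by rewrite e; ring.
Qed.

End LocalGenerators.

(** * Invertibility *)

(** The summands of [1 = a_1 b_1 + ... + a_n b_n] are elements of [S] that
    cannot all lie in the proper ideal [m]; one lying outside supplies the
    common denominator. *)
Lemma invertible_locally_principal (S : comPzSemiRingType) (I m : set S)
    (mP : prime_ideal m) :
  ideal I -> invertible I -> principal_ideal (loc_ideal (prime_compl mP) I).
Proof.
move=> idI [J fJ defS]; have [idm mT _] := mP.
have mulS x b : I x -> J b -> exists s, to_quotient s = to_quotient x * b.
  move=> Ix Jb; have : range (@to_quotient S) (to_quotient x * b).
    by rewrite -defS; apply: fractional_mul_mem => //; exists x.
  by case=> s _ <-; exists s.
have [n [a' [b [Ia' Jb e1]]]] : fractional_mul (@to_quotient S @` I) J (to_quotient 1).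
  by rewrite defS; exists 1.
have /choice[a aP] i : exists a, I a /\ to_quotient a = a' i.
  by have [a Ia <-] := Ia' i; exists a.
have /choice[s sP] i : exists s, to_quotient s = to_quotient (a i) * b i.
  by apply: mulS => //; case: (aP i).
have s1 : 1 = \sum_(i < n) s i.
  apply: to_quotient_inj; rewrite to_quotient_sum e1.
  by apply: eq_bigr => i _; rewrite sP; case: (aP i) => _ ->.
have [i nmi] : exists i, ~ m (s i).
  apply: contrapT => /forallNP ms; apply: (proper_ideal1 idm mT).
  by rewrite s1; apply: ideal_sum => // i; apply: contrapT; exact: ms.
have [Iai _] := aP i.
apply: (@principal_loc_ideal _ (prime_compl mP) _ _ _ idI Iai nmi) => x Ix.
have [r rP] := mulS x (b i) Ix (Jb i).
exists r; apply: to_quotient_inj; rewrite !to_quotientM rP sP.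
by rewrite [LHS]mulrC mulrCA [LHS]mulrC.
Qed.

(** The residual [(S : I)] in [Q(S)], the largest possible inverse of [I]. *)
Definition inverse_module (S : comPzSemiRingType) (I : set S) :
    set (total_quotient S) :=
  [set y | forall x, I x -> range (@to_quotient S) (to_quotient x * y)].

(** A cancellable element of [I] is itself a common denominator for
    [(S : I)]. *)
Lemma inverse_module_fractional (S : comPzSemiRingType) (I : set S) d :
  I d -> cancellable d -> fractional_ideal (inverse_module I).
Proof.
move=> Id cd; split.
- by exists 1 => x Ix; exists x; rewrite ?mulr1.
- move=> y z Jy Jz x Ix; have [s _ es] := Jy x Ix; have [t _ et] := Jz x Ix.
  by exists (s + t) => //; rewrite to_quotientD es et mulrDr.
- move=> s y Jy x Ix; have [t _ et] := Jy x Ix.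
  by exists (s * t) => //; rewrite to_quotientM et mulrCA.
- by exists d => // y; exact.
Qed.

Lemma mul_inverse_module_sub (S : comPzSemiRingType) (I : set S) :
  fractional_mul (@to_quotient S @` I) (inverse_module I)
    `<=` range (@to_quotient S).
Proof.
move=> _ [n [a [b [Ia Jb ->]]]].
have /choice[s sP] i : exists s, to_quotient s = a i * b i.
  by have [x Ix <-] := Ia i; have [s _ <-] := Jb i x Ix; exists s.
exists (\sum_i s i) => //; rewrite to_quotient_sum.
by apply: eq_bigr => i _; exact: sP.
Qed.

Lemma semidomain_ideal_cancellable (S : comNzSemiRingType) (I : set S) :
  semidomain S -> ideal I -> I <> [set 0] -> exists2 d, I d & cancellable d.
Proof.
move=> sdS idI I0; apply: contrapT => nd; apply: I0; apply/seteqP; split.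
  move=> x Ix; apply: contrapT => /= /eqP x0.
  by apply: nd; exists x => //; exact: sdS.
by move=> _ ->; exact: ideal0.
Qed.

(** At a maximal ideal [m] containing [I (S : I)], a relation [u I <= S a] with
    [u] outside [m] puts [u / a] in [(S : I)], hence [u] in [m]. The semidomain
    hypothesis makes the division by [a] possible. *)
Lemma locally_principal_invertible (S : comNzSemiRingType) (I : set S) :
  semidomain S -> ideal I -> I <> [set 0] -> finitely_generated I ->
  (forall (m : set S) (mP : maximal_ideal m),
     principal_ideal (loc_ideal (prime_compl (maximal_prime mP)) I)) ->
  invertible I.
Proof.
move=> sdS idI I0 fgI locI.
have [d Id cd] := semidomain_ideal_cancellable sdS idI I0.
have [_ ID IM] := idI.
pose J := inverse_module I; pose IJ := fractional_mul (@to_quotient S @` I) J.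
have IJZ s x : IJ x -> IJ (to_quotient s * x).
  apply: fractional_mulZ => _ [y Iy <-].
  by exists (s * y); [exact: IM|exact: to_quotientM].
exists J; first exact: inverse_module_fractional Id cd.
apply/seteqP; split; first exact: mul_inverse_module_sub.
pose K := [set s | IJ (to_quotient s)].
have idK : ideal K.
  split.
  - exists d; rewrite /K /= -[to_quotient d]mulr1.
    apply: fractional_mul_mem; first by exists d.
    by move=> x Ix; exists x; rewrite ?mulr1.
  - by move=> s t Ks Kt; rewrite /K /= to_quotientD; exact: fractional_mulD.
  - by move=> s t Kt; rewrite /K /= to_quotientM; exact: IJZ.
suff KT : K = setT by move=> _ [s _ <-]; have : K s by rewrite KT.
apply: (ideal_eq_setT idK) => m mP Km.
have [a [u [Ia mu uI]]] := loc_ideal_generator fgI (locI m mP).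
have [s ud] := uI d Id.
(* If [a = 0], then [u d = 0] with [d] cancellable, so [u = 0] would lie in
   [m]. *)
have ca : cancellable a.
  apply: sdS; apply/eqP => a0; apply: mu; rewrite a0 mulr0 in ud.
  have [idm _ _] := maximal_prime mP.
  suff -> : u = 0 by exact: ideal0.
  by apply: cd; rewrite mulr0 mulrC.
have [a' aa'] := to_quotient_unit ca.
apply: mu; apply: Km; rewrite /K /=.
have -> : to_quotient u = to_quotient a * (to_quotient u * a').
  by rewrite mulrCA aa' mulr1.
apply: fractional_mul_mem; first by exists a.
move=> x Ix; have [r e] := uI x Ix; exists r => //.
by rewrite mulrA -to_quotientM [x * u]mulrC e to_quotientM -mulrA aa' mulr1.
Qed.

Theorem theorem2p8 (S : comNzSemiRingType) (I : set S) :
  semidomain S -> ideal I -> I <> [set 0] -> finitely_generated I ->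
  (invertible I <->
   forall (m : set S) (mP : maximal_ideal m),
     principal_ideal (loc_ideal (prime_compl (maximal_prime mP)) I)).
Proof.
move=> sdS idI I0 fgI; split=> [invI m mP|].
  exact: invertible_locally_principal.
exact: locally_principal_invertible.
Qed.
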